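(* Let $q\ge0$. Let $\tilde H\in\mathbb{R}^{\mathcal I_N\times\mathcal I_N}$ be strictly lower triangular and let $\tau>0$. Let $\Lambda\in\mathbb{R}^{\mathcal I_N\times\mathcal I_N}$ be invertible and define $$\Phi=(P\Lambda P)^{-1},\qquad \mathcal R=\begin{bmatrix}\Lambda P&0&0\\0&0&1\\0&1&0\end{bmatrix}.$$ Then $$\mathcal L^{\mathrm{D,G}}_{\Lambda,\tilde H}=\mathcal R\,\mathcal L^{\mathrm{D,G}}_{\Phi,\tilde H^A}\,\mathcal R^\intercal.$$ It follows that $\Lambda$ is an unsigned certificate for (D,G) convergence of $\tilde H$ with rate $\tau$ if and only if $\Phi$ is an unsigned certificate for (D,G) convergence of $\tilde H^A$ with rate $\tau$. Moreover, if $\Lambda$ is symmetric, then $\Phi$ is also symmetric.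
   Context: $N\ge1$ is an integer, $\mathcal I_N=\{0,\dots,N\}$ indexes rows/columns, $e_0,\dots,e_N$ is the standard basis, $\mathbb{1}$ the all-ones vector. $S\in\mathbb{R}^{\mathcal I_N\times\mathcal I_N}$ has ones on and below the diagonal and zeros elsewhere, $R$ is the reversal permutation matrix, $P=SR$, the antitranspose is $X^A=RX^\intercal R$, and $\mathrm{sym}(X)=\frac12(X+X^\intercal)$. For strictly lower triangular $\tilde H$ put $H=(S^{-1}+\tilde H)((1+q)I+qS\tilde H)^{-1}$, $v_H=(I-qSH)\mathbb{1}$, $\eta_H=e_N^\intercal v_H$. For $\tau>0$ and a matrix $\Lambda$, the lifted slack matrix for (D,G) is the symmetric block matrix $$\mathcal L^{\mathrm{D,G}}_{\Lambda,\tilde H}=\begin{bmatrix}-2\,\mathrm{sym}(\Lambda SH)&\Lambda v_H&(I-qSH)^\intercal e_N\\ \cdot&\tau&q\eta_H\\ \cdot&\cdot&\tau\end{bmatrix}$$ (entries below the diagonal by symmetry; $\mathcal L^{\mathrm{D,G}}_{\Phi,\tilde H^A}$ is the same expression with $\Lambda,\tilde H$ replaced by $\Phi,\tilde H^A$, and $H$ replaced by the matrix built from $\tilde H^A$). Unsigned certificate: elements of $\mathbb{R}^d$ are row vectors. Given $y_0\in\mathbb{R}^d$, $\mathbf g\in\mathbb{R}^{\mathcal I_N\times d}$, let $\mathbf x=-SH\mathbf g+v_Hy_0$, $\mathbf s=\mathbf g+q\mathbf x$, $\mathbf y=\mathbf x+\mathbf s$, with rows $x_i,s_i,y_i$ (row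 $0$ of $\mathbf y$ is $y_0$). $\Lambda$ is an unsigned certificate for (D,G) convergence of $\tilde H$ with rate $\tau$ if $\frac\tau2\|y_0\|^2-\frac1{2\tau}\|s_N\|^2+\mathrm{tr}(\mathbf g^\intercal\Lambda\mathbf x)\ge0$ for all $(y_0,\mathbf g)$; in the operator setting ($\frac{1-\mu}{1+\mu}$-contractive operators, $q=\mu/(1-\mu)$), as opposed to the function setting ($1$-smooth $\mu$-strongly convex functions), $\Lambda$ is additionally required to be symmetric. The claim holds in both settings. *)

(* Defs.v *)
From HB Require Import structures.
From mathcomp Require Import all_boot all_order all_algebra all_fingroup.
From mathcomp Require Import reals.

Set Implicit Arguments.
Unset Strict Implicit.
Unset Printing Implicit Defensive.

Import Order.TTheory GRing.Theory Num.Theory.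
Local Open Scope ring_scope.

(* Rows and columns are indexed by {0, ..., N}, i.e. by 'I_N.+1. *)

Definition summation_mx (R : realType) (N : nat) : 'M[R]_N.+1 :=
  \matrix_(i, j) (j <= i)%N%:R.

Definition reversal_mx (R : realType) (N : nat) : 'M[R]_N.+1 :=
  perm_mx (perm (@rev_ord_inj N.+1)).

Definition P_mx (R : realType) (N : nat) : 'M[R]_N.+1 :=
  summation_mx R N *m reversal_mx R N.

Definition antitranspose (R : realType) (N : nat) (X : 'M[R]_N.+1) :
    'M[R]_N.+1 :=
  reversal_mx R N *m X^T *m reversal_mx R N.

Definition sym_part (R : realType) (n : nat) (X : 'M[R]_n) : 'M[R]_n :=
  2^-1 *: (X + X^T).

(* [is_trig_mx] from the library allows a nonzero diagonal. *)
Definition strictly_lower_triangular (R : realType) (n : nat) (X : 'M[R]_n) :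
    Prop :=
  forall i j : 'I_n, (i <= j)%N -> X i j = 0.

Definition ones (R : realType) (N : nat) : 'cV[R]_N.+1 := const_mx 1.

Definition e_last (R : realType) (N : nat) : 'cV[R]_N.+1 := delta_mx ord_max 0.

(* For strictly lower triangular Ht and 0 <= q both inverted matrices are
   lower triangular with positive diagonal, so [invmx] is a true inverse. *)
Definition H_mx (R : realType) (N : nat) (q : R) (Ht : 'M[R]_N.+1) :
    'M[R]_N.+1 :=
  let S := summation_mx R N in
  (invmx S + Ht) *m invmx ((1 + q) *: 1%:M + q *: (S *m Ht)).

Definition I_sub_qSH (R : realType) (N : nat) (q : R) (Ht : 'M[R]_N.+1) :
    'M[R]_N.+1 :=
  1%:M - q *: (summation_mx R N *m H_mx q Ht).

Definition v_vec (R : realType) (N : nat) (q : R) (Ht : 'M[R]_N.+1) :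
    'cV[R]_N.+1 :=
  I_sub_qSH q Ht *m ones R N.

Definition eta (R : realType) (N : nat) (q : R) (Ht : 'M[R]_N.+1) : R :=
  ((e_last R N)^T *m v_vec q Ht) 0 0.

Definition lifted_slack (R : realType) (N : nat) (q tau : R)
    (Lam Ht : 'M[R]_N.+1) : 'M[R]_(N.+1 + (1 + 1)) :=
  let S := summation_mx R N in
  let b := Lam *m v_vec q Ht in
  let c := (I_sub_qSH q Ht)^T *m e_last R N in
  block_mx (- 2 *: sym_part (Lam *m S *m H_mx q Ht)) (row_mx b c)
           (col_mx b^T c^T)
           (block_mx tau%:M (q * eta q Ht)%:M (q * eta q Ht)%:M tau%:M).

Definition transfer_mx (R : realType) (N : nat) (Lam : 'M[R]_N.+1) :
    'M[R]_(N.+1 + (1 + 1)) :=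
  block_mx (Lam *m P_mx R N) 0
           0 (block_mx 0 1%:M
                       1%:M 0).

(* The library norm on matrices is the sup norm, hence this definition. *)
Definition sqnorm (R : realType) (d : nat) (u : 'rV[R]_d) : R :=
  \sum_(k < d) u 0 k ^+ 2.

Definition x_seq (R : realType) (N d : nat) (q : R) (Ht : 'M[R]_N.+1)
    (y0 : 'rV[R]_d) (g : 'M[R]_(N.+1, d)) : 'M[R]_(N.+1, d) :=
  - (summation_mx R N *m H_mx q Ht *m g) + v_vec q Ht *m y0.

Definition s_seq (R : realType) (N d : nat) (q : R) (Ht : 'M[R]_N.+1)
    (y0 : 'rV[R]_d) (g : 'M[R]_(N.+1, d)) : 'M[R]_(N.+1, d) :=
  g + q *: x_seq q Ht y0 g.

(* With q = mu / (1 - mu), 0 <= mu < 1: (1 - mu)/(1 + mu)-contractive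
   operators, resp. 1-smooth mu-strongly convex functions. The certificate
   inequality is common to both; only operators require symmetry. *)
Inductive setting := OperatorSetting | FunctionSetting.

Definition unsigned_certificate (R : realType) (st : setting) (N d : nat)
    (q tau : R) (Ht Lam : 'M[R]_N.+1) : Prop :=
  (st = OperatorSetting -> Lam^T = Lam) /\
  (forall (y0 : 'rV[R]_d) (g : 'M[R]_(N.+1, d)),
     0 <= tau / 2 * sqnorm y0
          - (2 * tau)^-1 * sqnorm (row ord_max (s_seq q Ht y0 g))
          + \tr (g^T *m Lam *m x_seq q Ht y0 g)).

(* Main.v *)
Require Import Defs.
From HB Require Import structures.
From mathcomp Require Import all_boot all_order all_algebra all_fingroup.
From mathcomp Require Import reals ring.

Set Implicit Arguments.
Unset Strict Implicit.
Unset Printing Implicit Defensive.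

Import Order.TTheory GRing.Theory Num.Theory.
Local Open Scope ring_scope.

(** The theorem is a change of variables by the matrix P = SR. Put A = S Ht and
D = (1 + q) I + q A. Since S (S^-1 + Ht) = I + A and D - q (I + A) = I,
<<
  S H = (I + A) D^-1        and        I - q S H = D^-1,
>>
so everything that the slack matrix needs is a rational function of A
([summation_H_mxE], [I_sub_qSHE]). Because R Ht^T R = Ht^A and P is symmetric,
the matrix A' = S Ht^A of the antitransposed method satisfies A' P = P A^T
([antitranspose_intertwine]): up to conjugation by P, antitransposition is
transposition. This relation passes to D, to D^-1 and, the factors I + A and
D^-1 commuting, to S H. As the last column of P is the all-ones vector,
P e_N = 1, the two border columns v_H = D^-1 1 and D^-T e_N are exchanged as
well, and eta_H = e_N^T D^-1 1 is unchanged. With Lam P Phi P = I this is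
exactly what the block computation of the congruence requires
([slack_block_congruence]).

For the certificates, the congruence must be turned into an equivalence of
inequalities. The certificate expression is half the Schur complement of the
lifted slack matrix L with respect to its last diagonal entry tau > 0: for W
with blocks g, y0, w, the form tr (W^T L W) is twice that expression plus
tau |w + s_N / tau|^2 ([lifted_slack_form]). Hence the certificate inequality
holds for all (y0, g) iff tr (W^T L W) is nonnegative for all W having d
columns, and the latter is invariant under congruence by the invertible
transfer matrix. The symmetry demanded for operators also transfers both ways,
because Phi^-1 = P Lam P with P symmetric and invertible. Keeping d columns throughout treats every d, zero included,
in the same way. *)

(** * Congruence of slack matrices *)

(** The shape common to both lifted slack matrices, with M, v, c, h in place of
S H, v_H, (I - q S H)^T e_N and q eta_H. *)
Definition slack_block (R : realType) n (tau h : R) (Lam M : 'M[R]_n)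
    (v c : 'cV[R]_n) : 'M[R]_(n + (1 + 1)) :=
  block_mx (- 2 *: sym_part (Lam *m M)) (row_mx (Lam *m v) c)
           (col_mx (Lam *m v)^T c^T)
           (block_mx tau%:M h%:M h%:M tau%:M).

Lemma lifted_slackE (R : realType) N (q tau : R) (Lam Ht : 'M[R]_N.+1) :
  lifted_slack q tau Lam Ht =
  slack_block tau (q * Defs.eta q Ht) Lam (summation_mx R N *m H_mx q Ht)
    (v_vec q Ht) ((I_sub_qSH q Ht)^T *m e_last R N).
Proof. by rewrite /lifted_slack -mulmxA. Qed.

(** Congruence by Lam P sends Phi M' to the transpose of Lam M, which the
symmetric part does not see; the swap in T reflects that the roles of the two
border columns are exchanged. *)
Lemma slack_block_congruence (R : realType) n (tau h : R)
    (P Lam Phi M M' : 'M[R]_n) (v v' c c' : 'cV[R]_n) :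
  P^T = P -> Lam *m P *m Phi *m P = 1%:M ->
  M' *m P = P *m M^T -> v' = P *m c -> v = P *m c' ->
  let T := block_mx (Lam *m P) 0 0 (block_mx 0 1%:M 1%:M 0) in
  slack_block tau h Lam M v c = T *m slack_block tau h Phi M' v' c' *m T^T.
Proof.
move=> trP LPPhiP M'P -> -> /=.
have diag : Lam *m P *m (Phi *m M') *m (Lam *m P)^T = (Lam *m M)^T.
  rewrite !trmx_mul trP -[RHS]mul1mx -LPPhiP -!mulmxA.
  by rewrite [M' *m _]mulmxA M'P -!mulmxA.
have border : Lam *m P *m row_mx (Phi *m (P *m c)) c'
      *m (block_mx 0 1%:M 1%:M 0)^T = row_mx (Lam *m (P *m c')) c.
  rewrite tr_block_mx !trmx0 !trmx1 mul_mx_row mul_row_block.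
  by rewrite !mulmx0 !mulmx1 add0r addr0 !mulmxA LPPhiP mul1mx.
rewrite tr_block_mx /slack_block !mulmx_block !trmx0.
rewrite !mul0mx !mulmx0 !addr0 !add0r; congr block_mx.
- rewrite /sym_part -!scalemxAr -!scalemxAl; do 2!congr (_ *: _).
  rewrite mulmxDr mulmxDl diag addrC; congr (_ + _).
  by rewrite -[LHS]trmxK -diag !trmx_mul !trmxK !mulmxA.
- by rewrite border.
- by rewrite -!tr_row_mx -border !trmx_mul !trmxK !mulmxA.
- rewrite tr_block_mx !trmx0 !trmx1 !mulmx_block.
  by rewrite !mulmx0 !addr0 !add0r !mul1mx !mulmx1.
Qed.

(** * The matrices S, R and P *)

Section SummationReversal.
Variables (R : realType) (N : nat).
Local Notation S := (summation_mx R N).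
Local Notation J := (reversal_mx R N).
Local Notation P := (P_mx R N).

Lemma summation_mx_unit : S \in unitmx.
Proof.
have trigS : is_trig_mx S.
  by apply/is_trig_mxP => i j ltij; rewrite mxE leqNgt ltij.
rewrite unitmxE det_trig // big1 ?unitr1 // => i _.
by rewrite mxE leqnn.
Qed.

Lemma reversal_mx_involutive : J *m J = 1%:M.
Proof.
rewrite /reversal_mx -perm_mxM -[RHS]perm_mx1; congr perm_mx.
by apply/permP => i; rewrite permM !permE rev_ordK.
Qed.

Lemma tr_reversal_mx : J^T = J.
Proof.
rewrite tr_perm_mx; congr perm_mx; apply/permP => i.
by apply: (canLR (permK _)); rewrite !permE rev_ordK.
Qed.

Lemma P_mxE i j : P i j = (N - j <= i)%N%:R.
Proof.
rewrite /P_mx /reversal_mx mxE (bigD1 (rev_ord j)) //= big1 => [|k neq_kj].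
  by rewrite !mxE permE rev_ordK eqxx mulr1 addr0 /= subSS.
rewrite !mxE permE (_ : (_ == j) = false) ?mulr0 //.
by apply: contraNF neq_kj => /eqP<-; rewrite rev_ordK.
Qed.

Lemma P_mx_sym : P^T = P.
Proof. by apply/matrixP => i j; rewrite mxE !P_mxE !leq_subLR addnC. Qed.

Lemma P_mx_unit : P \in unitmx.
Proof.
rewrite unitmx_mul summation_mx_unit.
by case: (mulmx1_unit reversal_mx_involutive).
Qed.

Lemma P_mx_e_last : P *m e_last R N = ones R N.
Proof.
by apply/matrixP => i j; rewrite ord1 /e_last -colE mxE P_mxE mxE /= subnn.
Qed.

(** Both sides are P X^T R P: on the right because S^T = R P, which is the
symmetry of P read through S = P R. *)
Lemma antitranspose_intertwine (X : 'M[R]_N.+1) :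
  (S *m antitranspose X) *m P = P *m (S *m X)^T.
Proof.
have trS : S^T = J *m P.
  have SE : S = P *m J by rewrite -mulmxA reversal_mx_involutive mulmx1.
  by rewrite {1}SE trmx_mul P_mx_sym tr_reversal_mx.
by rewrite trmx_mul trS /antitranspose !mulmxA.
Qed.

(** * The method matrices as functions of S Ht *)

Section Method.
Variables (q : R) (Ht : 'M[R]_N.+1).
Local Notation D := ((1 + q) *: 1%:M + q *: (S *m Ht)).
Local Notation Ha := (antitranspose Ht).
Local Notation Da := ((1 + q) *: 1%:M + q *: (S *m Ha)).

(** S Ht is strictly lower triangular, so D is lower triangular with constant
diagonal 1 + q > 0. *)
Lemma denominator_unit :
  0 <= q -> strictly_lower_triangular Ht -> D \in unitmx.
Proof.
move=> q_ge0 ltHt.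
have SHt0 (i j : 'I_N.+1) : (i <= j)%N -> (S *m Ht) i j = 0.
  move=> leij; rewrite mxE big1 // => k _; rewrite mxE.
  have [leki|] := leqP k i; last by rewrite mul0r.
  by rewrite ltHt ?mulr0 // (leq_trans leki).
have DE (i j : 'I_N.+1) :
    D i j = (1 + q) * (i == j)%:R + q * (S *m Ht) i j by rewrite !mxE.
have trigD : is_trig_mx D.
  apply/is_trig_mxP => i j ltij; rewrite DE SHt0 1?ltnW // -val_eqE.
  by rewrite ltn_eqF // !mulr0 addr0.
rewrite unitmxE det_trig // unitfE; apply/prodf_neq0 => i _.
by rewrite DE SHt0 // eqxx mulr0 addr0 mulr1 gt_eqF // ltr_wpDr.
Qed.

Lemma summation_H_mxE : S *m H_mx q Ht = (1%:M + S *m Ht) *m invmx D.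
Proof. by rewrite /H_mx mulmxA mulmxDr mulmxV // summation_mx_unit. Qed.

Hypothesis uD : D \in unitmx.

Lemma I_sub_qSHE : I_sub_qSH q Ht = invmx D.
Proof.
rewrite /I_sub_qSH summation_H_mxE -{1}(mulmxV uD).
rewrite [q *: (_ *m invmx _)]scalemxAl -mulmxBl.
rewrite [X in X *m _](_ : _ = 1%:M) ?mul1mx //.
by rewrite scalerDl scalerDr scale1r -[_ + _ + q *: _]addrA addrK.
Qed.

(** The reversed order of the factors is what a transpose produces. *)
Lemma summation_H_mxEC : S *m H_mx q Ht = invmx D *m (1%:M + S *m Ht).
Proof.
rewrite summation_H_mxE; apply: (canLR (mulmxK uD)).
have AD : (1%:M + S *m Ht) *m D = D *m (1%:M + S *m Ht).
  rewrite mulmxDl mul1mx mulmxDr mulmx1; congr (_ + _).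
  by rewrite mulmxDr mulmxDl -!scalemxAr -!scalemxAl mulmx1 mul1mx.
by rewrite -mulmxA AD mulKmx.
Qed.

Lemma denominator_intertwine : Da *m P = P *m D^T.
Proof.
rewrite mulmxDl -!scalemxAl antitranspose_intertwine.
by rewrite linearD !linearZ /= trmx1 mulmxDr -!scalemxAr mulmx1 mul1mx.
Qed.

Lemma denominator_antitranspose_unit : Da \in unitmx.
Proof.
rewrite -[Da](mulmxK P_mx_unit) denominator_intertwine.
by rewrite unitmx_mul unitmx_inv P_mx_unit andbT unitmx_mul P_mx_unit unitmx_tr.
Qed.

End Method.

(** * Antitransposition as transposition conjugated by P *)

Section Duality.
Variables (q : R) (Ht : 'M[R]_N.+1).
Hypothesis uD : (1 + q) *: 1%:M + q *: (S *m Ht) \in unitmx.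
Local Notation Ha := (antitranspose Ht).

Lemma I_sub_qSH_intertwine : I_sub_qSH q Ha *m P = P *m (I_sub_qSH q Ht)^T.
Proof.
have uDa := denominator_antitranspose_unit uD.
rewrite !I_sub_qSHE // trmx_inv; apply: (canRL (mulmxK _)).
  by rewrite unitmx_tr.
by rewrite -mulmxA -denominator_intertwine mulKmx.
Qed.

Lemma summation_H_intertwine :
  (S *m H_mx q Ha) *m P = P *m (S *m H_mx q Ht)^T.
Proof.
have uDa := denominator_antitranspose_unit uD.
have numerator : (1%:M + S *m Ha) *m P = P *m (1%:M + S *m Ht)^T.
  rewrite mulmxDl antitranspose_intertwine linearD /= trmx1.
  by rewrite mulmxDr mul1mx mulmx1.
rewrite summation_H_mxE (summation_H_mxEC uD) trmx_mul -!I_sub_qSHE //.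
by rewrite -mulmxA I_sub_qSH_intertwine [LHS]mulmxA numerator [RHS]mulmxA.
Qed.

(** The all-ones vector, on which the input column v_H is built, is P e_N:
moving P across turns the input column into the output column. *)
Lemma v_vec_antitranspose :
  v_vec q Ha = P *m ((I_sub_qSH q Ht)^T *m e_last R N).
Proof.
by rewrite /v_vec -P_mx_e_last [LHS]mulmxA I_sub_qSH_intertwine mulmxA.
Qed.

Lemma output_antitranspose :
  P *m ((I_sub_qSH q Ha)^T *m e_last R N) = v_vec q Ht.
Proof.
rewrite mulmxA -{1}P_mx_sym -trmx_mul I_sub_qSH_intertwine trmx_mul trmxK.
by rewrite P_mx_sym -mulmxA P_mx_e_last.
Qed.

Lemma eta_antitranspose : Defs.eta q Ha = Defs.eta q Ht.
Proof.
rewrite /Defs.eta v_vec_antitranspose mulmxA -{1}P_mx_sym -trmx_mul P_mx_e_last.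
transitivity (((e_last R N)^T *m v_vec q Ht)^T 0 0); last by rewrite mxE.
by rewrite /v_vec !trmx_mul trmxK mulmxA.
Qed.

Lemma lifted_slack_congruence tau Lam Phi :
  Lam *m P *m Phi *m P = 1%:M ->
  lifted_slack q tau Lam Ht =
  transfer_mx Lam *m lifted_slack q tau Phi Ha *m (transfer_mx Lam)^T.
Proof.
move=> LPPhiP; rewrite !lifted_slackE eta_antitranspose.
apply: slack_block_congruence => //.
- exact: P_mx_sym.
- exact: summation_H_intertwine.
- exact: v_vec_antitranspose.
- by rewrite output_antitranspose.
Qed.

End Duality.

Lemma transfer_mx_unit (Lam : 'M[R]_N.+1) :
  Lam \in unitmx -> transfer_mx Lam \in unitmx.
Proof.
move=> uLam; rewrite unitmxE det_ublock unitrM -!unitmxE.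
rewrite unitmx_mul uLam P_mx_unit /=.
have swapK : block_mx 0 1%:M 1%:M 0 *m block_mx 0 1%:M 1%:M 0 =
    1%:M :> 'M[R]_(1 + 1).
  rewrite mulmx_block !mul0mx !mulmx0 !mulmx1 !addr0 !add0r.
  by rewrite -scalar_mx_block.
by case: (mulmx1_unit swapK).
Qed.

(** * Certificates as nonnegativity of the lifted slack form *)

Lemma sqnorm_trace d (u : 'rV[R]_d) : sqnorm u = \tr (u^T *m u).
Proof.
rewrite mxtrace_mulC /mxtrace big_ord1 mxE; apply: eq_bigr => k _.
by rewrite mxE expr2.
Qed.

Lemma sqnorm_ge0 d (u : 'rV[R]_d) : 0 <= sqnorm u.
Proof. by apply: sumr_ge0 => k _; exact: sqr_ge0. Qed.

Lemma mxtrace_tr_mulC m d (u v : 'M[R]_(m, d)) :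
  \tr (u^T *m v) = \tr (v^T *m u).
Proof. by rewrite -mxtrace_tr trmx_mul trmxK. Qed.

(** The quadratic form attached to a matrix L, on column vectors with values in
the d-dimensional space of the iterates. *)
Definition slack_nonneg n (d : nat) (L : 'M[R]_n) : Prop :=
  forall W : 'M[R]_(n, d), 0 <= \tr (W^T *m L *m W).

Lemma slack_nonneg_congruence n d (T L : 'M[R]_n) :
  T \in unitmx -> slack_nonneg d (T *m L *m T^T) <-> slack_nonneg d L.
Proof.
move=> uT; split=> posL W; last first.
  by have := posL (T^T *m W); rewrite trmx_mul trmxK !mulmxA.
have := posL (invmx T^T *m W); rewrite !mulmxA -[_ *m T^T *m _]mulmxA.
rewrite mulmxV ?unitmx_tr // mulmx1 trmx_mul -trmx_inv trmxK.
by rewrite -[W^T *m _ *m T]mulmxA mulVmx ?mulmx1.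
Qed.

Section Certificate.
Variables (q tau : R) (Ht Lam : 'M[R]_N.+1).

(** The coefficients of s_N in (g, y0) are the off-diagonal entries of the last
column of the slack matrix: this is why its Schur complement contains
|s_N|^2. *)
Lemma last_s_seq d (y0 : 'rV[R]_d) g :
  row ord_max (s_seq q Ht y0 g) =
  ((I_sub_qSH q Ht)^T *m e_last R N)^T *m g + (q * Defs.eta q Ht) *: y0.
Proof.
have -> : s_seq q Ht y0 g =
    I_sub_qSH q Ht *m g + q *: (v_vec q Ht *m y0).
  rewrite /s_seq /x_seq scalerDr scalerN addrA; congr (_ + _).
  by rewrite [RHS]mulmxBl mul1mx -scalemxAl.
rewrite rowE (_ : delta_mx 0 _ = (e_last R N)^T); last by rewrite trmx_delta.
rewrite mulmxDr [(_^T *m _)^T]trmx_mul trmxK mulmxA; congr (_ + _).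
rewrite -scalemxAr mulmxA [X in X *m y0]mx11_scalar mul_scalar_mx.
by rewrite scalerA.
Qed.

Hypothesis tau_gt0 : 0 < tau.

(** Completing the square in w: the terms of the form that contain w are
tau |w|^2 + 2 <w, s_N>. *)
Lemma lifted_slack_form d (y0 w : 'rV[R]_d) g :
  \tr ((col_mx g (col_mx y0 w))^T *m lifted_slack q tau Lam Ht
         *m col_mx g (col_mx y0 w)) =
  2 * (tau / 2 * sqnorm y0
          - (2 * tau)^-1 * sqnorm (row ord_max (s_seq q Ht y0 g))
          + \tr (g^T *m Lam *m x_seq q Ht y0 g))
  + tau * sqnorm (w + tau^-1 *: row ord_max (s_seq q Ht y0 g)).
Proof.
rewrite /lifted_slack last_s_seq /x_seq.
set c := _^T *m e_last R N; set h := q * _; set v := v_vec q Ht.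
rewrite -mulmxA !mul_block_col !mul_row_col !mul_col_mx !tr_col_mx.
rewrite !mul_scalar_mx !add_col_mx !mul_row_col !sqnorm_trace.
set s := c^T *m g + h *: y0; set M := S *m H_mx q Ht.
rewrite -[Lam *m S *m _]mulmxA -/M.
have dots : \tr (w^T *m s) = \tr (w^T *m (c^T *m g)) + h * \tr (w^T *m y0).
  by rewrite mulmxDr mxtraceD -scalemxAr mxtraceZ.
rewrite addrA [c^T *m g + _]addrA -/s addrA -[g^T *m Lam *m _]mulmxA.
(* s must not be unfolded while the products are expanded. *)
move: s dots => s dots; rewrite /sym_part.
rewrite [(w + _)^T]linearD /= [(_ *: s)^T]linearZ /=.
rewrite !(mulmxDr, mulmxDl, mulmxN, mxtraceD) -!scalemxAl -!scalemxAr.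
rewrite !mxtraceZ raddfN /= [(_ + _^T) *m g]mulmxDl mulmxDr mxtraceD.
have -> : \tr (g^T *m ((Lam *m M)^T *m g)) = \tr (g^T *m (Lam *m (M *m g))).
  by rewrite mulmxA -trmx_mul mxtrace_tr_mulC -!mulmxA.
have -> : \tr (y0^T *m ((Lam *m v)^T *m g)) = \tr (g^T *m (Lam *m (v *m y0))).
  by rewrite mulmxA -trmx_mul mxtrace_tr_mulC -!mulmxA.
have -> : \tr (g^T *m (c *m w)) = \tr (w^T *m (c^T *m g)).
  by rewrite mxtrace_tr_mulC trmx_mul -mulmxA.
rewrite [\tr (y0^T *m w)]mxtrace_tr_mulC [\tr (s^T *m w)]mxtrace_tr_mulC dots.
rewrite -!mulmxA; field; exact: lt0r_neq0.
Qed.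

Lemma unsigned_certificateP st d :
  unsigned_certificate st d q tau Ht Lam <->
  (st = OperatorSetting -> Lam^T = Lam) /\
  slack_nonneg d (lifted_slack q tau Lam Ht).
Proof.
split=> -[symLam pos]; (split=> //); [move=> W | move=> y0 g].
  rewrite -[W]vsubmxK -[dsubmx W]vsubmxK lifted_slack_form.
  by rewrite addr_ge0 ?mulr_ge0 ?sqnorm_ge0 ?(ltW tau_gt0) //.
(* w = - s_N / tau makes the square vanish. *)
have := pos (col_mx g (col_mx y0 (- (tau^-1 *: row ord_max (s_seq q Ht y0 g))))).
rewrite lifted_slack_form addNr [sqnorm 0]big1 => [|k _].
  by rewrite mulr0 addr0 pmulr_rge0.
by rewrite mxE expr0n.
Qed.

End Certificate.

End SummationReversal.

Theorem theorem2 (R : realType) (N : nat) (q tau : R)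
    (Ht Lam Phi : 'M[R]_N.+1)
    (hN : (1 <= N)%N) (hq : 0 <= q)
    (hHt : strictly_lower_triangular Ht) (htau : 0 < tau)
    (hLam : Lam \in unitmx)
    (hPhi : Phi = invmx (P_mx R N *m Lam *m P_mx R N)) :
  lifted_slack q tau Lam Ht =
    transfer_mx Lam *m lifted_slack q tau Phi (antitranspose Ht)
      *m (transfer_mx Lam)^T
  /\ (forall (st : setting) (d : nat),
        unsigned_certificate st d q tau Ht Lam <->
        unsigned_certificate st d q tau (antitranspose Ht) Phi)
  /\ (Lam^T = Lam -> Phi^T = Phi).
Proof.
have trP := P_mx_sym R N; have uP := P_mx_unit R N.
have uD := denominator_unit hq hHt.
(* Only symmetry and invertibility of P matter from here on, and leaving P
   transparent would let rewriting with associativity split it as S R. *)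
have := lifted_slack_congruence uD tau (Lam := Lam) (Phi := Phi).
move: (transfer_mx_unit hLam).
move: (transfer_mx Lam) (P_mx R N) trP uP hPhi => T P trP uP hPhi uT congrL.
have uPLP : P *m Lam *m P \in unitmx by rewrite !unitmx_mul uP hLam.
have symE : Phi^T = Phi <-> Lam^T = Lam.
  have trPLP : (P *m Lam *m P)^T = P *m Lam^T *m P.
    by rewrite !trmx_mul trP mulmxA.
  rewrite hPhi trmx_inv trPLP; split=> [/(can_inj (@invmxK _ _)) | -> //].
  by move=> /(can_inj (mulmxK uP)) /(can_inj (mulKmx uP)).
have {}congrL : lifted_slack q tau Lam Ht =
    T *m lifted_slack q tau Phi (antitranspose Ht) *m T^T.
  by apply: congrL; apply: mulmx1C; rewrite !mulmxA hPhi mulmxV.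
split; first exact: congrL.
split=> [st d|]; last by case: symE.
apply: (iff_trans (unsigned_certificateP q Ht Lam htau st d)).
apply: iff_sym; apply: (iff_trans (unsigned_certificateP _ _ _ htau st d)).
rewrite congrL.
have transport := slack_nonneg_congruence d
  (lifted_slack q tau Phi (antitranspose Ht)) uT.
by split=> -[symX posX]; (split; [move=> /symX /symE | apply/transport]).
Qed.
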